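(* Let $A$ be a closed densely defined operator in $H$ and let $B\in B(H)$ be such that $\sigma(B^*A^* )\neq\mathbb{C}$ and $\sigma(BA)\neq\mathbb{C}$. If either $\ker(A^* )=\ker(A)$ or $\ker(B)=\ker(B^* )$, then $$\sigma(BA)=\sigma(AB).$$
   Context: $H$ is a complex separable Hilbert space; operators are linear, possibly unbounded; $B(H)$ is the set of everywhere defined bounded linear operators on $H$. For operators $S,T$ in $H$, $ST$ has domain $\{x\in D(T): Tx\in D(S)\}$. Spectrum: for an operator $T$ with domain $D(T)\subset H$ (not necessarily bounded, closed or densely defined), $\lambda\in\mathbb{C}$ is not in $\sigma(T)$ iff $T-\lambda$ is injective and $(T-\lambda)^{-1}\in B(H)$. *)

(* Defs.v *)
From HB Require Import structures.
From mathcomp Require Import all_boot all_order all_algebra.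
From mathcomp Require Import complex.
From mathcomp Require Import all_classical all_reals all_analysis.

Set Implicit Arguments.
Unset Strict Implicit.
Unset Printing Implicit Defensive.

Import Order.TTheory GRing.Theory Num.Theory.
Import numFieldNormedType.Exports.

Local Open Scope classical_set_scope.
Local Open Scope complex_scope.
Local Open Scope ring_scope.

(* The inner product is linear in its first argument and conjugate-linear in
   the second. *)
HB.mixin Record CompleteNormedModule_isHilbert (R : realType) H
    of CompleteNormedModule R[i] H := {
  hdot : {dot H for (@Num.conj R[i])} ;
  sqr_norm_hdot : forall x : H, `|x| ^+ 2 = hdot x x
}.

#[short(type="hilbertType")]
HB.structure Definition Hilbert (R : realType) :=
  {H of CompleteNormedModule R[i] H & CompleteNormedModule_isHilbert R H}.

Definition separable (T : topologicalType) : Prop :=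
  exists2 D : set T, countable D & dense D.

(* A partial map on H. The values of [opfun] outside [opdom] are irrelevant:
   nothing below depends on them. *)
Record operator (H : Type) := Operator {
  opdom : set H ;
  opfun :> H -> H
}.

Section Operators.
Context {R : realType} {H : hilbertType R}.
Implicit Types S T : operator H.

Definition linear_operator T : Prop :=
  [/\ opdom T 0,
      forall (a : R[i]) x y, opdom T x -> opdom T y -> opdom T (a *: x + y) &
      forall (a : R[i]) x y, opdom T x -> opdom T y ->
        T (a *: x + y) = a *: T x + T y].

Definition densely_defined T : Prop := dense (opdom T).

Definition opgraph T : set (H * H) := [set (x, T x) | x in opdom T].

Definition closed_operator T : Prop := closed (opgraph T).

(* Membership in B(H). *)
Definition bounded_operator T : Prop :=
  [/\ opdom T = setT, linear_operator T &
      exists M : R[i], forall x, `|T x| <= M * `|x|].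

Definition opker T : set H := [set x | opdom T x /\ T x = 0].

Definition opcomp S T : operator H :=
  Operator [set x | opdom T x /\ opdom S (T x)] (fun x => S (T x)).

(* T - l *)
Definition opshift T (l : R[i]) : operator H :=
  Operator (opdom T) (fun x => T x - l *: x).

(* The vector z = T^* y is unique when T is densely defined; [xget] only picks
   it out. The notion is meaningful for densely defined T only. *)
Definition adjoint T : operator H :=
  let adj y z := forall x, opdom T x -> hdot (T x) y = hdot x z in
  Operator [set y | exists z, adj y z] (fun y => xget 0 [set z | adj y z]).

Definition injective_operator T : Prop :=
  forall x y, opdom T x -> opdom T y -> T x = T y -> x = y.

(* The domain is the range of T; meaningful for injective T only. *)
Definition opinv T : operator H :=
  Operator [set T x | x in opdom T]
    (fun y => xget 0 [set x | opdom T x /\ T x = y]).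

Definition spectrum T : set R[i] :=
  [set l | ~ (injective_operator (opshift T l) /\
              bounded_operator (opinv (opshift T l)))].

End Operators.

(* Main.v *)
Require Import Defs.
From mathcomp Require Import all_boot all_order all_algebra.
From mathcomp Require Import complex.
From mathcomp Require Import all_classical all_reals all_analysis.
From mathcomp Require Import ring lra.

(** For a closed operator T, the complement of the spectrum is the set of the
   l such that T - l is bijective, because a bijection with closed graph has a
   bounded inverse (closed graph theorem, [closed_graph] and [resolventP]).
   Both products are closed here: AB because A is closed and B continuous
   ([opcomp_boundedr_closed]), and BA because it has a resolvent at some m
   ([closed_of_resolvent]). So the theorem says that BA - l and AB - l are
   bijective for the same l.

   For l nonzero this is algebra. If R inverts BA - l, then (A R B - 1) / l
   inverts AB - l ([bijective_shift_swap]). In the other direction the formula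
   (B R A - 1) / l makes sense on the domain of A only, so that BA - l is
   injective with a range that contains that domain; as the inverse of BA - m
   maps everything into the domain of A and commutes with BA - l, the range is
   everything ([bijective_shift_swapV]).

   For l = 0 the kernels matter. If one of the products is bijective, then its
   right factor is injective and its left factor surjective, and it suffices to
   show that one of A and B is bijective. Let T be the one that has the same
   kernel as its adjoint. As ker T* is the orthogonal of the range of T
   ([opker_adjointP]), T is injective if and only if its range is dense. So a
   surjective T is bijective, and an injective T has a dense range. In the
   latter situation that range is the set of fixed points of a continuous map,
   hence closed, hence everything by the projection theorem
   ([range_fixpoints_full]). The map is y |-> A (BA)^-1 B y if T = A. If T = B,
   it is the projection onto ran B along ker A: the bijectivity of AB and of
   BA - m makes H the direct sum of these two subspaces
   ([bijective_opcomp_AB_BA]). The closed graph theorem shows that both maps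
   are continuous. *)

Set Implicit Arguments.
Unset Strict Implicit.
Unset Printing Implicit Defensive.

Import Order.TTheory GRing.Theory Num.Theory.
Import numFieldNormedType.Exports.

Local Open Scope classical_set_scope.
Local Open Scope complex_scope.
Local Open Scope ring_scope.

(** * Real-valued norms and completeness *)

Section RealNorm.
Context {R : realType}.
Implicit Types V : normedModType R[i].

(** The norm of a complex normed module takes its values in R[i], which is only
   partially ordered; its real part allows the order reasoning of R. *)
Definition rnorm V (x : V) : R := complex.Re `|x|.

Lemma rnormE V (x : V) : `|x| = (rnorm x)%:C.
Proof. by rewrite /rnorm RRe_real ?normr_real. Qed.

Lemma rnorm_ge0 V (x : V) : 0 <= rnorm x.
Proof. by rewrite -(lecR 0) -rnormE normr_ge0. Qed.

Lemma rnorm0 V : rnorm (0 : V) = 0.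
Proof. by rewrite /rnorm normr0. Qed.

Lemma rnorm_eq0 V (x : V) : rnorm x = 0 -> x = 0.
Proof. by move=> x0; apply/eqP; rewrite -normr_eq0 rnormE x0. Qed.

Lemma rnormN V (x : V) : rnorm (- x) = rnorm x.
Proof. by rewrite /rnorm normrN. Qed.

Lemma rnormB V (x y : V) : rnorm (x - y) = rnorm (y - x).
Proof. by rewrite /rnorm distrC. Qed.

Lemma rnorm_triangle V (x y z : V) :
  rnorm (x - y) <= rnorm (x - z) + rnorm (z - y).
Proof. by rewrite -lecR rmorphD/= -!rnormE ler_distD. Qed.

Lemma rnormZ V (a : R) (x : V) : 0 <= a -> rnorm (a%:C *: x) = a * rnorm x.
Proof.
move=> a0; apply: complexI; rewrite rmorphM/= -!rnormE normrZ ger0_norm//.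
by rewrite (lecR 0).
Qed.

Lemma cvg_rnormP V (u : nat -> V) (l : V) :
  u @ \oo --> l <->
  forall e : R, 0 < e -> \forall n \near \oo, rnorm (l - u n) < e.
Proof.
split=> [/cvgrPdist_lt ul e e0|ul].
  have e0' : 0 < e%:C by rewrite (ltcR 0).
  by have := ul _ e0'; apply: filterS => n; rewrite rnormE ltcR.
apply/cvgrPdist_lt => e e0.
have eE : e = (complex.Re e)%:C by rewrite RRe_real// gtr0_real.
rewrite eE; move: e0; rewrite eE (ltcR 0) => /ul.
by apply: filterS => n; rewrite rnormE ltcR.
Qed.

Lemma rcauchy_cvg (V : completeNormedModType R[i]) (u : nat -> V) :
  (forall e : R, 0 < e ->
    exists N, forall n, (N <= n)%N -> rnorm (u N - u n) < e) ->
  exists l : V, u @ \oo --> l.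
Proof.
move=> cu; suff /cvg_ex[l ul] : cvg (u @ \oo) by exists l.
apply: cauchy_cvg; apply: cauchy_exP => e e0.
have eE : e = (complex.Re e)%:C by rewrite RRe_real// gtr0_real.
move: e0; rewrite eE (ltcR 0) => /cu[N uN].
exists (u N); exists N => // n /= Nn.
by rewrite -ball_normE /= rnormE ltcR uN.
Qed.

Lemma le_of_cvg V (u : nat -> V) (l x : V) (r : R) :
  u @ \oo --> l -> (\forall n \near \oo, rnorm (u n - x) <= r) ->
  rnorm (l - x) <= r.
Proof.
move=> /cvg_rnormP ul ur; rewrite leNgt; apply/negP => rl.
have e0 : 0 < rnorm (l - x) - r by lra.
near \oo => n.
have h1 : rnorm (l - u n) < rnorm (l - x) - r by near: n; exact: ul.
have h2 : rnorm (u n - x) <= r by near: n.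
have := rnorm_triangle l x (u n); lra.
Unshelve. all: by end_near. Qed.

(** The bound r n * (n + 1) <= 2 * r 0 suffices for convergence and follows by
   induction from n + 2 <= 2 (n + 1). *)
Lemma halving_cvg0 (r : nat -> R) :
  (forall n, 0 <= r n) -> (forall n, r n.+1 <= r n / 2) ->
  forall e : R, 0 < e -> \forall n \near \oo, r n < e.
Proof.
move=> r0 rh e e0.
have geo n : r n * n.+1%:R <= r 0%N * 2.
  elim: n => [|n IH]; first by rewrite mulr1; have := r0 0%N; lra.
  apply: le_trans IH; rewrite -(natr1 n.+1) -(natr1 n).
  have n0 : (0 : R) <= n%:R by rewrite ler0n.
  have := mulr_ge0 (r0 n) n0.
  have := ler_wpM2r (addr_ge0 n0 (ler0n R 2)) (rh n).
  by lra.
pose N := Num.truncn (r 0%N * 2 / e).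
exists N => // n /= Nn.
have : r 0%N * 2 / e < n.+1%:R.
  by apply: lt_le_trans (truncnS_gt _) _; rewrite ler_nat.
rewrite ltr_pdivrMr// => h.
have n0 : (0 : R) < n.+1%:R by rewrite ltr0n.
by rewrite -(ltr_pM2r n0); have := geo n; lra.
Qed.

(** The second hypothesis says that the closed balls of centers u n and radii
   r n are nested. Both the Baire argument and the summation argument in the
   closed graph theorem rest on this. *)
Lemma nested_balls (V : completeNormedModType R[i]) (u : nat -> V)
    (r : nat -> R) :
  (forall n, 0 <= r n) ->
  (forall n, rnorm (u n.+1 - u n) + r n.+1 <= r n) ->
  (forall n, r n.+1 <= r n / 2) ->
  exists2 l : V, u @ \oo --> l & forall n, rnorm (l - u n) <= r n.
Proof.
move=> r0 ur rh.
have dist n k : rnorm (u (n + k)%N - u n) <= r n - r (n + k)%N.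
  elim: k => [|k IH]; first by rewrite addn0 !subrr rnorm0.
  have := rnorm_triangle (u (n + k).+1) (u n) (u (n + k)%N).
  by rewrite addnS; have := ur (n + k)%N; lra.
have [l ul] : exists l : V, u @ \oo --> l.
  apply: rcauchy_cvg => e e0.
  have [N _ /(_ N (leqnn N)) rN] := halving_cvg0 r0 rh e0.
  exists N => n /subnKC <-; rewrite rnormB; apply: le_lt_trans (dist _ _) _.
  by have := r0 (N + (n - N))%N; lra.
exists l => // n; apply: (le_of_cvg ul); exists n => // m /= /subnKC <-.
by apply: le_trans (dist _ _) _; have := r0 (n + (m - n))%N; lra.
Qed.

End RealNorm.

(** * The closed graph theorem *)

Section ClosedGraph.
Context {R : realType} {V W : completeNormedModType R[i]}.
Variable f : V -> W.
Hypothesis f_linear : forall (a : R[i]) x y, f (a *: x + y) = a *: f x + f y.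

Let fB x y : f (x - y) = f x - f y.
Proof. by rewrite addrC -scaleN1r f_linear scaleN1r addrC. Qed.

Let f0 : f 0 = 0.
Proof. by rewrite -(subrr 0) fB subrr. Qed.

Let fZ a x : f (a *: x) = a *: f x.
Proof. by rewrite -[a *: x]addr0 f_linear f0 addr0. Qed.

(** Baire category argument: otherwise, nested balls can be chosen such that
   for every n the norm of f exceeds n on one of them, which is impossible at
   their common point. *)
Lemma sublevel_dense_in_ball :
  exists (n : nat) (a : V) (r : R), 0 < r /\
    forall y, rnorm (y - a) < r -> forall s : R, 0 < s ->
    exists z, rnorm (y - z) < s /\ rnorm (f z) <= n%:R.
Proof.
apply: contrapT => none.
have /choice[g gP] (np : nat * (V * R)) : exists q : V * R, 0 < np.2.2 ->
    [/\ 0 < q.2, rnorm (q.1 - np.2.1) + q.2 <= np.2.2, q.2 <= np.2.2 / 2 &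
        forall z, rnorm (q.1 - z) <= q.2 -> np.1%:R < rnorm (f z)].
  case: np => n p /=.
  have [r0|] := ltP 0 p.2; last by exists p.
  apply: contrapT => nq; apply: none; exists n, p.1, p.2; split=> // y yp s s0.
  apply: contrapT => nz; apply: nq.
  exists (y, Num.min (s / 2) (Num.min (p.2 - rnorm (y - p.1)) (p.2 / 2))).
  move=> _ /=.
  set t := Num.min _ _.
  have [ts tr tp] : [/\ t <= s / 2, t <= p.2 - rnorm (y - p.1) & t <= p.2 / 2].
    by rewrite /t !ge_min !lexx !orbT.
  split=> //; last 1 first.
  - move=> z yz; rewrite ltNge; apply/negP => fz; apply: nz; exists z.
    split=> //.
    lra.
  - by rewrite /t !lt_min; apply/and3P; split; lra.
  - lra.
pose p := fix p n := if n is m.+1 then g (m, p m) else (0 : V, 1 : R).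
have p0 n : 0 < (p n).2.
  by elim: n => [|n p0]; [exact: ltr01 | have [] := gP (n, p n) p0].
have [n||n|l _ lp] := nested_balls (u := fst \o p) (r := snd \o p).
- exact: ltW (p0 n).
- by move=> n; have [_] := gP (n, p n) (p0 n).
- by have [_ _] := gP (n, p n) (p0 n).
pose n := (Num.truncn (rnorm (f l))).+1.
have [_ _ _ /(_ l)] := gP (n, p n) (p0 n).
rewrite rnormB => /(_ (lp n.+1)).
by apply/negP; rewrite -leNgt ltW// truncnS_gt.
Qed.

(** The ball in which a sublevel set of f is dense is moved to the origin by
   taking differences, then to all radii by homogeneity. *)
Lemma approximate_preimage_bound : exists2 K : R, 0 <= K &
  forall y (s : R), 0 < s ->
    exists z, rnorm (y - z) <= s /\ rnorm (f z) <= K * rnorm y.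
Proof.
have [n [a [r [r0 dn]]]] := sublevel_dense_in_ball.
exists (4 * n%:R / r); first by rewrite divr_ge0 ?mulr_ge0 ?ler0n// ltW.
move=> y s s0; have [->|y0] := eqVneq y 0.
  by exists 0; rewrite subrr f0 !rnorm0 mulr0 lexx ltW.
have {}y0 : 0 < rnorm y.
  rewrite lt_def rnorm_ge0 andbT; apply: contra_neq y0; exact: rnorm_eq0.
(* This scaling brings y into the ball of radius r. *)
pose t := r / (2 * rnorm y); have t0 : 0 < t by rewrite divr_gt0// mulr_gt0.
have ts0 : 0 < t * s / 2 by rewrite divr_gt0// mulr_gt0.
have [|z1 [az1 fz1]] := dn (t%:C *: y + a) _ _ ts0.
  rewrite addrK rnormZ ?ltW// /t invfM mulrA divfK ?gt_eqF//.
  by rewrite ltr_pdivrMr//; lra.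
have [|z0 [az0 fz0]] := dn a _ _ ts0; first by rewrite subrr rnorm0.
have yE : y = (t^-1)%:C *: (t%:C *: y).
  by rewrite scalerA -rmorphM/= mulVf ?scale1r// gt_eqF.
have tV0 : 0 <= t^-1 by rewrite invr_ge0 ltW.
exists ((t^-1)%:C *: (z1 - z0)); split.
  rewrite {1}yE -scalerBr rnormZ// ler_pdivrMl//.
  have -> : t%:C *: y - (z1 - z0) = (t%:C *: y + a - z1) - (a - z0).
    by rewrite !opprB (addrAC _ a) addrACA subrr addr0 addrA addrAC.
  have := rnorm_triangle (t%:C *: y + a - z1) (a - z0) 0.
  by rewrite subr0 sub0r rnormN; lra.
rewrite fZ rnormZ// fB.
have -> : 4 * n%:R / r * rnorm y = t^-1 * (2 * n%:R).
  by rewrite /t invf_div; field; rewrite gt_eqF.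
rewrite ler_pM2l ?invr_gt0//.
by have := rnorm_triangle (f z1) (f z0) 0; rewrite subr0 sub0r rnormN; lra.
Qed.

(** Successive approximation: x is the sum of vectors z_n with
   |f z_n| <= K |x| / 2^n. The partial sums converge to x, their images converge
   to a vector of norm at most 2 K |x|, and the closed graph identifies that
   vector with f x. *)
Theorem closed_graph : closed [set p : V * W | p.2 = f p.1] ->
  exists M : R, forall x, rnorm (f x) <= M * rnorm x.
Proof.
move=> cf; have [K K0 aK] := approximate_preimage_bound.
have /choice[z zP] (p : V * R) : exists z : V, 0 < p.2 ->
    rnorm (p.1 - z) <= p.2 /\ rnorm (f z) <= K * rnorm p.1.
  have [s0|] := ltP 0 p.2; last by exists 0.
  by have [z ?] := aK p.1 p.2 s0; exists z.
exists (2 * K) => x; have [->|x0] := eqVneq x 0.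
  by rewrite f0 !rnorm0 mulr0.
have {}x0 : 0 < rnorm x.
  rewrite lt_def rnorm_ge0 andbT; apply: contra_neq x0; exact: rnorm_eq0.
pose e n := rnorm x / 2 ^+ n.
have e0 n : 0 < e n by rewrite divr_gt0// exprn_gt0.
have eS n : e n.+1 = e n / 2 by rewrite /e exprS invfM mulrA mulrAC.
(* y n is the remainder, so that x - y n is the n-th partial sum. *)
pose y := fix y n := if n is m.+1 then y m - z (y m, e m.+1) else x.
have yS n : y n.+1 = y n - z (y n, e n.+1) by [].
have ye n : rnorm (y n) <= e n.
  case: n => [|n]; first by rewrite /e expr0 divr1.
  by have [] := zP (y n, e n.+1) (e0 _).
have fz n : rnorm (f (z (y n, e n.+1))) <= K * e n.
  have [_ /le_trans] := zP (y n, e n.+1) (e0 _); apply.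
  exact: ler_wpM2l (ye n).
have [n|n|n|l ul lb] := nested_balls (u := fun n => f (x - y n))
    (r := fun n => 2 * K * e n).
- by rewrite mulr_ge0 ?mulr_ge0// ltW.
- rewrite yS -fB.
  have -> : x - (y n - z (y n, e n.+1)) - (x - y n) = z (y n, e n.+1).
    by rewrite !opprB addrC !addrA subrK addrAC subrr add0r.
  by have := fz n; rewrite /= eS; lra.
- by rewrite /= eS; lra.
have xl : (fun n => x - y n) @ \oo --> x.
  apply/cvg_rnormP => d d0.
  have [n|n|N _ eN] := halving_cvg0 (r := e) _ _ d0.
  + exact: ltW.
  + by rewrite eS.
  exists N => // n /eN; apply: le_lt_trans.
  by rewrite opprB addrC subrK.
have <- : l = f x.
  suff : [set p : V * W | p.2 = f p.1] (x, l) by [].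
  apply: (@closed_cvg _ _ \oo eventually_filter
    (fun n => (x - y n, f (x - y n))) _ cf).
    exact: nearW.
  exact: cvg_pair.
by have := lb 0%N; rewrite subrr f0 subr0 /e expr0 divr1.
Qed.
End ClosedGraph.

(** * The projection theorem *)

Section Projection.
Context {R : realType} {H : hilbertType R}.
Implicit Types x y z v : H.


Lemma sqr_rnorm x : ((rnorm x) ^+ 2)%:C = hdot x x.
Proof. by rewrite -sqr_norm_hdot rnormE rmorphXn. Qed.

Lemma parallelogram x y :
  rnorm (x + y) ^+ 2 + rnorm (x - y) ^+ 2 = 2 * (rnorm x ^+ 2 + rnorm y ^+ 2).
Proof.
apply: complexI; rewrite mulr_natl mulr2n !rmorphD/= !sqr_rnorm dnormD dnormB.
by rewrite addrACA subrr addr0.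
Qed.

(** Subtracting from y its component along v decreases the square of its norm by
   |<y, v>|^2 / |v|^2, so that this component vanishes if 0 is the multiple of v
   nearest to y. *)
Lemma nearest_orthogonal (y v : H) :
  (forall a : R[i], rnorm y <= rnorm (y - a *: v)) -> hdot y v = 0.
Proof.
move=> ymin; have [->|v0] := eqVneq v 0; first by rewrite linear0r.
have vv0 : 0 < hdot v v by rewrite dnorm_gt0.
pose a := hdot y v / hdot v v.
have : hdot y y <= hdot (y - a *: v) (y - a *: v).
  by rewrite -!sqr_rnorm lecR lerXn2r// nnegrE rnorm_ge0.
rewrite dnormB dnormZ linearZr_LR /=.
pose c := `|hdot y v| ^+ 2 / hdot v v.
have c0 : 0 <= c by rewrite divr_ge0 ?exprn_ge0// ltW.
have -> : `|a| ^+ 2 * hdot v v = c.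
  rewrite /a normrM normfV (gtr0_norm vv0) exprMn exprVn -mulrA.
  by congr (_ * _); rewrite expr2 invfM mulfVK ?gt_eqF.
have -> : a^* * hdot y v = c.
  rewrite /a rmorphM/= fmorphV/= (geC0_conj (ltW vv0)) mulrAC.
  by rewrite [_^* * _]mulrC -normCK.
rewrite geC0_conj// -addrA lerDl opprD addrA subrr add0r oppr_ge0 => c_le0.
have /eqP : c = 0 by apply/eqP; rewrite eq_le c_le0.
by rewrite mulf_eq0 invr_eq0 (gt_eqF vv0) orbF expf_eq0/= normr_eq0 => /eqP.
Qed.

(** If m is the point of M nearest to x, then x - m is orthogonal to M. The
   parallelogram law makes every minimizing sequence Cauchy, since the midpoint
   of two points of M is no closer to x than the distance d. *)
Lemma projection_theorem (M : set H) :
  closed M -> M 0 -> (forall (a : R[i]) x y, M x -> M y -> M (a *: x + y)) ->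
  (forall y, (forall v, M v -> hdot v y = 0) -> y = 0) -> M = setT.
Proof.
move=> Mcl M0 Mlin Mperp; apply/seteqP; split=> // x _.
pose d := inf [set rnorm (x - m) | m in M].
have dlb : lbound [set rnorm (x - m) | m in M] 0.
  by move=> _ [m _ <-]; exact: rnorm_ge0.
have dinf : has_inf [set rnorm (x - m) | m in M].
  by split; [exists (rnorm (x - 0)), 0 | exists 0].
have d_le m : M m -> d <= rnorm (x - m).
  by move=> Mm; apply: ge_inf; [exists 0 | exists m].
have d0 : 0 <= d by apply: lb_le_inf dlb; case: dinf.
have /choice[m mP] (n : nat) : exists m, M m /\ rnorm (x - m) < d + n.+1%:R^-1.
  have n0 : (0 : R) < n.+1%:R^-1 by rewrite invr_gt0.
  by have [_ [m Mm <-] ?] := inf_adherent n0 dinf; exists m.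
have close m1 m2 : M m1 -> M m2 ->
    rnorm (m1 - m2) ^+ 2 <=
      2 * (rnorm (x - m1) ^+ 2 + rnorm (x - m2) ^+ 2) - 4 * d ^+ 2.
  move=> Mm1 Mm2; have := parallelogram (x - m1) (x - m2).
  have -> : x - m1 - (x - m2) = m2 - m1.
    by rewrite opprB addrC addrA subrK.
  have Mmid : M ((2^-1)%:C *: (m1 + m2)).
    rewrite -[_ *: _]addr0; apply: (Mlin) => //.
    by rewrite -[m1]scale1r; exact: (Mlin).
  have -> : x - m1 + (x - m2) = (2 : R)%:C *: (x - (2^-1)%:C *: (m1 + m2)).
    rewrite scalerBr scalerA -rmorphM/= mulfV// scale1r.
    by rewrite addrACA -opprD rmorphMn/= scaler_nat mulr2n.
  rewrite rnormZ// exprMn (rnormB m2) => <-.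
  have := d_le _ Mmid; move: (rnorm (x - _)) => t dt.
  have : d ^+ 2 <= t ^+ 2 by rewrite lerXn2r ?nnegrE// (le_trans d0).
  by lra.
have [l ml] : exists l : H, m @ \oo --> l.
  apply: rcauchy_cvg => e e0.
  have [N [a [a0 Na a_small]]] : exists N (a : R), [/\ 0 <= a,
      forall n, (N <= n)%N -> n.+1%:R^-1 <= a &
      8 * d * a + 4 * a ^+ 2 < e ^+ 2].
    pose N := Num.truncn ((8 * d + 4) / e ^+ 2).
    have : (8 * d + 4) / e ^+ 2 < N.+1%:R by rewrite truncnS_gt.
    rewrite ltr_pdivrMr ?exprn_gt0// => Ne.
    have N0 : (0 : R) < N.+1%:R by rewrite ltr0n.
    exists N, N.+1%:R^-1; split; first by rewrite invr_ge0 ler0n.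
      by move=> n Nn; rewrite lef_pV2 ?posrE// ler_nat.
    rewrite -(ltr_pM2l N0); apply: le_lt_trans Ne.
    have -> : N.+1%:R * (8 * d * N.+1%:R^-1 + 4 * N.+1%:R^-1 ^+ 2) =
        8 * d + 4 * N.+1%:R^-1.
      by move: N0 => /gt_eqF/negbT; move: (N.+1%:R) => t t0; field.
    by rewrite lerD2l ler_piMr// invf_le1// ler1n.
  exists N => n Nn; rewrite ltNge; apply/negP => e_le.
  have dist k : (N <= k)%N -> rnorm (x - m k) ^+ 2 <= (d + a) ^+ 2.
    move=> Nk; rewrite lerXn2r ?nnegrE ?rnorm_ge0 ?addr_ge0//.
    by rewrite (le_trans (ltW (mP k).2))// lerD2l Na.
  have : e ^+ 2 <= rnorm (m N - m n) ^+ 2.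
    by rewrite lerXn2r ?nnegrE ?rnorm_ge0 ?(ltW e0).
  have := close _ _ (mP N).1 (mP n).1.
  have := dist _ (leqnn N); have := dist _ Nn.
  by lra.
have Ml : M l.
  apply: (@closed_cvg _ _ \oo eventually_filter _ _ Mcl _ _ ml).
  by apply: nearW => n; have [] := mP n.
have xl_le : rnorm (x - l) <= d.
  rewrite rnormB; apply/ler_addgt0Pr => e e0; apply: (le_of_cvg ml).
  exists (Num.truncn e^-1) => // n /= Nn.
  have := (mP n).2; rewrite rnormB => /ltW /le_trans; apply.
  rewrite lerD2l -[e]invrK lef_pV2 ?posrE ?invr_gt0//.
  apply: le_trans (ltW (truncnS_gt _)) _; by rewrite ler_nat.
suff : x - l = 0 by move/eqP; rewrite subr_eq0 => /eqP->.
apply: Mperp => v Mv.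
rewrite hermC/= expr0 mul1r (@nearest_orthogonal _ v) ?conjC0//.
move=> a; apply: le_trans xl_le _; rewrite -addrA -opprD; apply: d_le.
by rewrite addrC; exact: (Mlin).
Qed.

End Projection.

(** * Continuity of linear maps *)

Lemma bounded_additive_continuous {R : realType} {V W : normedModType R[i]}
    (f : V -> W) (M : R) :
  (forall x y, f (x - y) = f x - f y) ->
  (forall x, rnorm (f x) <= M * rnorm x) -> continuous f.
Proof.
move=> fB fM x; apply/cvgrPdist_lt => e e0.
have eE : e = (complex.Re e)%:C by rewrite RRe_real// gtr0_real.
move: e0; rewrite eE (ltcR 0) => e0.
have M0 : 0 < `|M| + 1 by rewrite ltr_wpDl.
have d0 : 0 < (complex.Re e / (`|M| + 1))%:C by rewrite (ltcR 0) divr_gt0.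
near=> y; have : `|x - y| < (complex.Re e / (`|M| + 1))%:C.
  by near: y; exact: cvgr_dist_lt.
rewrite !rnormE !ltcR -fB ltr_pdivlMr// => xy.
apply: le_lt_trans (fM _) _; apply: le_lt_trans xy; rewrite mulrC.
by rewrite ler_wpM2l ?rnorm_ge0// (le_trans (ler_norm M))// lerDl.
Unshelve. all: by end_near. Qed.

Lemma closed_graph_continuous {R : realType} {V W : completeNormedModType R[i]}
    (f : V -> W) :
  (forall (a : R[i]) x y, f (a *: x + y) = a *: f x + f y) ->
  closed [set p : V * W | p.2 = f p.1] -> continuous f.
Proof.
move=> fl fc; have [M fM] := closed_graph fl fc.
apply: bounded_additive_continuous fM => x y.
by rewrite addrC -scaleN1r fl scaleN1r addrC.
Qed.

Lemma closed_eq_continuous {R : realType} {T : topologicalType}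
    {V : normedModType R[i]} (f g : T -> V) :
  continuous f -> continuous g -> closed [set x | f x = g x].
Proof.
move=> fc gc.
have -> : [set x | f x = g x] = (fun x => f x - g x) @^-1` [set 0].
  apply/seteqP; split=> x /=; first by move=> ->; rewrite subrr.
  by move/eqP; rewrite subr_eq0 => /eqP.
apply: preimage_closed; last first.
  exact/accessible_closed_set1/hausdorff_accessible/norm_hausdorff.
by move=> x _; apply: cvgB; [exact: fc|exact: gc].
Qed.

(** * Unbounded operators and their resolvent sets *)

Section Operators.
Context {R : realType} {H : hilbertType R}.
Implicit Types A B T : operator H.

Definition bijective_operator T : Prop :=
  injective_operator T /\ forall y, exists2 x, opdom T x & T x = y.

Section Linear.
Variable T : operator H.
Hypothesis T_linear : linear_operator T.

Lemma opdom0 : opdom T 0. Proof. by case: T_linear. Qed.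

Lemma opdomP a x y : opdom T x -> opdom T y -> opdom T (a *: x + y).
Proof. by case: T_linear => _ + _; apply. Qed.

Lemma oplinearP a x y :
  opdom T x -> opdom T y -> T (a *: x + y) = a *: T x + T y.
Proof. by case: T_linear => _ _; apply. Qed.

Lemma opdomZ a x : opdom T x -> opdom T (a *: x).
Proof.
by move=> Tx; rewrite -[_ *: _]addr0; apply: opdomP => //; exact: opdom0.
Qed.

Lemma opdomD x y : opdom T x -> opdom T y -> opdom T (x + y).
Proof. by move=> Tx Ty; rewrite -[x]scale1r; exact: opdomP. Qed.

Lemma opdomB x y : opdom T x -> opdom T y -> opdom T (x - y).
Proof. by move=> Tx Ty; rewrite addrC -scaleN1r; exact: opdomP. Qed.

Lemma oplinearB x y : opdom T x -> opdom T y -> T (x - y) = T x - T y.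
Proof.
by move=> Tx Ty; rewrite addrC -scaleN1r oplinearP// scaleN1r addrC.
Qed.

Lemma oplinear0 : T 0 = 0.
Proof. by have := oplinearB opdom0 opdom0; rewrite !subrr. Qed.

Lemma oplinearZ a x : opdom T x -> T (a *: x) = a *: T x.
Proof.
move=> Tx; rewrite -[_ *: _]addr0 oplinearP//; last exact: opdom0.
by rewrite oplinear0 addr0.
Qed.

Lemma injective_operatorP :
  injective_operator T <-> forall x, opdom T x -> T x = 0 -> x = 0.
Proof.
split=> [injT x Tx Tx0|kerT x y Tx Ty Txy].
  by apply: injT => //; [exact: opdom0 | rewrite oplinear0].
apply: subr0_eq; apply: kerT; rewrite ?oplinearB ?Txy ?subrr//.
exact: opdomB.
Qed.

Lemma opshift_linear l : linear_operator (opshift T l).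
Proof.
split=> /=; [exact: opdom0 | exact: opdomP |].
move=> a x y Tx Ty; rewrite oplinearP// scalerDr scalerBr opprD addrACA.
by rewrite !scalerA [l * a]mulrC.
Qed.

End Linear.

Lemma opgraphE T x y : opgraph T (x, y) <-> opdom T x /\ T x = y.
Proof.
by split=> [[z Tz [<- <-]]|[Tx <-]]; [|exists x].
Qed.

Lemma opshift_closed T l : closed_operator T -> closed_operator (opshift T l).
Proof.
move=> Tc; rewrite /closed_operator.
have -> : opgraph (opshift T l) =
    (fun p : H * H => (p.1, p.2 + l *: p.1)) @^-1` opgraph T.
  apply/seteqP; split=> -[x y] /=.
    by move=> /opgraphE/= [Tx <-]; apply/opgraphE; rewrite subrK.
  by move=> /opgraphE/= [Tx Txy]; apply/opgraphE; rewrite /= Txy addrK.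
apply: preimage_closed => // p _; apply: cvg_pair; first exact: cvg_fst.
by apply: cvgD; [exact: cvg_snd | apply: cvgZr; exact: cvg_fst].
Qed.

Lemma opinvP T y : (exists2 x, opdom T x & T x = y) ->
  opdom T (opinv T y) /\ T (opinv T y) = y.
Proof.
by move=> [x Tx Txy]; apply: (@xgetI _ 0 [set x | opdom T x /\ T x = y] x).
Qed.

Lemma opinvE T x : injective_operator T -> opdom T x -> opinv T (T x) = x.
Proof.
move=> injT Tx; have [] := @opinvP T (T x); first by exists x.
by move=> Tx' /injT; exact.
Qed.

Lemma opinv_linear T : linear_operator T -> bijective_operator T ->
  forall (a : R[i]) x y, opinv T (a *: x + y) = a *: opinv T x + opinv T y.
Proof.
move=> lT [injT surT] a x y.
have [[Tx xE] [Ty yE]] := (opinvP (surT x), opinvP (surT y)).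
by rewrite -{1}xE -{1}yE -oplinearP// opinvE//; exact: opdomP.
Qed.

Lemma bounded_operator_continuous B : bounded_operator B -> continuous B.
Proof.
move=> [domB lB [M BM]].
apply: (@bounded_additive_continuous _ _ _ _ (complex.Re `|M|)).
  by move=> x y; rewrite oplinearB// domB.
move=> x; rewrite -lecR rmorphM/= -!rnormE.
have -> : (complex.Re `|M|)%:C = `|M| by rewrite RRe_real ?normr_real.
rewrite -[X in _ <= _ * X]normr_id -normrM ger0_norm ?BM//.
exact: le_trans (BM x).
Qed.

Lemma opinv_bounded T : linear_operator T -> closed_operator T ->
  bijective_operator T -> bounded_operator (opinv T).
Proof.
move=> lT cT bT; have lTV := opinv_linear lT bT.
have [|M TM] := closed_graph lTV.
  have -> : [set p : H * H | p.2 = opinv T p.1] =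
      (fun p : H * H => (p.2, p.1)) @^-1` opgraph T.
    apply/seteqP; split=> -[y x] /=.
      by move=> ->; apply/opgraphE; apply: opinvP; exact: bT.2.
    by move=> /opgraphE/= [Tx <-]; exact: esym (opinvE bT.1 Tx).
  apply: preimage_closed => // p _; apply: cvg_pair.
    exact: cvg_snd.
  exact: cvg_fst.
have domTV : opdom (opinv T) = setT.
  by apply/seteqP; split=> // y _; have [x Tx Txy] := bT.2 y; exists x.
split=> //; first by split=> [|a x y _ _|a x y _ _]; rewrite ?domTV.
by exists M%:C => x; rewrite !rnormE -rmorphM lecR.
Qed.

Lemma bijective_of_resolvent T l :
  ~ spectrum T l -> bijective_operator (opshift T l).
Proof.
move=> /contrapT[injT [domT _ _]]; split=> // y.
by have : opdom (opinv (opshift T l)) y by rewrite domT.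
Qed.

(** The closed graph theorem makes the boundedness of the inverse automatic. *)
Lemma resolventP T l : linear_operator T -> closed_operator T ->
  ~ spectrum T l <-> bijective_operator (opshift T l).
Proof.
move=> lT cT; split=> [|bT]; first exact: bijective_of_resolvent.
apply; split; first exact: bT.1.
by apply: opinv_bounded => //; [exact: opshift_linear|exact: opshift_closed].
Qed.

(** The graph of T is the set of the pairs (x, y) with (T - l)^-1 (y - l x) = x,
   an equality between continuous functions of (x, y). *)
Lemma closed_of_resolvent T l : ~ spectrum T l -> closed_operator T.
Proof.
move=> rT; have [injT surT] := bijective_of_resolvent rT.
have /bounded_operator_continuous cK : bounded_operator (opinv (opshift T l)).
  by have /contrapT[] := rT.
rewrite /closed_operator.
have -> : opgraph T =
    [set p : H * H | opinv (opshift T l) (p.2 - l *: p.1) = p.1].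
  apply/seteqP; split=> -[x y] /=.
    by move=> /opgraphE[Tx <-]; exact: (@opinvE (opshift T l)).
  move=> KE; apply/opgraphE.
  have {}KE : opinv (opshift T l) (y - l *: x) = x := KE.
  by have [] := opinvP (surT (y - l *: x)); rewrite KE /= => Tx /addIr.
apply: closed_eq_continuous => p; last exact: cvg_fst.
apply: (@continuous_comp _ _ _ (fun p : H * H => p.2 - l *: p.1)).
  by apply: cvgB; [exact: cvg_snd | apply: cvgZr; exact: cvg_fst].
exact: cK.
Qed.

Lemma opshift0 T : opshift T 0 = T.
Proof.
by case: T => D f; congr Operator; apply/funext => x; rewrite /= scale0r subr0.
Qed.

(** * Nonzero spectral points of the two products *)

Section Product.
Variables A B : operator H.
Hypotheses (A_linear : linear_operator A) (B_bounded : bounded_operator B).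

Let Bdom x : opdom B x. Proof. by case: B_bounded => ->. Qed.
Let B_linear : linear_operator B. Proof. by case: B_bounded. Qed.

Lemma opcomp_boundedl_linear : linear_operator (opcomp B A).
Proof.
split=> /=; first by split; [exact: opdom0|exact: Bdom].
  by move=> a x y [Ax _] [Ay _]; split; [exact: opdomP|exact: Bdom].
by move=> a x y [Ax _] [Ay _]; rewrite !oplinearP.
Qed.

Lemma opcomp_boundedr_linear : linear_operator (opcomp A B).
Proof.
split=> /=; first by rewrite oplinear0//; split; [exact: Bdom|exact: opdom0].
  move=> a x y [_ ABx] [_ ABy]; rewrite oplinearP//.
  by split; [exact: Bdom|exact: opdomP].
by move=> a x y [_ ABx] [_ ABy]; rewrite !oplinearP.
Qed.

(** The graph of AB is the preimage of the graph of A under the continuous map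
   (x, y) |-> (B x, y). *)
Lemma opcomp_boundedr_closed :
  closed_operator A -> closed_operator (opcomp A B).
Proof.
move=> cA; rewrite /closed_operator.
have -> : opgraph (opcomp A B) =
    (fun p : H * H => (B p.1, p.2)) @^-1` opgraph A.
  apply/seteqP; split=> -[x y] /=.
    by move=> /opgraphE/= [[_ ABx] <-]; apply/opgraphE.
  by move=> /opgraphE/= [ABx <-]; apply/opgraphE; split=> //; split.
apply: preimage_closed => // p _; apply: cvg_pair; last exact: cvg_snd.
apply: (@continuous_comp _ _ _ fst); first exact: cvg_fst.
exact: bounded_operator_continuous.
Qed.

(** If (BA - l) u = B y, then x = (A u - y) / l satisfies B x = u, and it
   follows that (AB - l) x = y. *)
Lemma bijective_shift_swap l : l != 0 ->
  bijective_operator (opshift (opcomp B A) l) ->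
  bijective_operator (opshift (opcomp A B) l).
Proof.
move=> l0 [injBA surBA]; split.
  apply/injective_operatorP; first exact/opshift_linear/opcomp_boundedr_linear.
  move=> x [_ ABx] /= /subr0_eq ABxl.
  have Bx0 : B x = 0.
    have /injective_operatorP := injBA; apply => //=.
      exact/opshift_linear/opcomp_boundedl_linear.
    by rewrite ABxl oplinearZ// subrr.
  move: ABxl; rewrite Bx0 oplinear0// => /esym/eqP.
  by rewrite scaler_eq0 (negPf l0) => /eqP.
move=> y; have [u [Au _] /= uE] := surBA (B y).
have BxE : B (l^-1 *: (A u - y)) = u.
  rewrite oplinearZ// oplinearB// -uE opprB addrC subrK.
  by rewrite scalerA mulVf// scale1r.
exists (l^-1 *: (A u - y)); first by rewrite /= BxE.
by rewrite /= BxE scalerA mulfV// scale1r opprB addrC subrK.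
Qed.

(** The point m extends the surjectivity of BA - l from the domain of A to the
   whole space. *)
Lemma bijective_shift_swapV l m : l != 0 ->
  bijective_operator (opshift (opcomp B A) m) ->
  bijective_operator (opshift (opcomp A B) l) ->
  bijective_operator (opshift (opcomp B A) l).
Proof.
move=> l0 [injBAm surBAm] [injAB surAB]; split.
  apply/injective_operatorP; first exact/opshift_linear/opcomp_boundedl_linear.
  move=> x [Ax _] /= /subr0_eq BAxl.
  have Ax0 : A x = 0.
    have /injective_operatorP := injAB; apply => //=.
    - exact/opshift_linear/opcomp_boundedr_linear.
    - by rewrite BAxl; split=> //; exact: opdomZ.
    - by rewrite BAxl oplinearZ// subrr.
  move: BAxl; rewrite Ax0 oplinear0// => /esym/eqP.
  by rewrite scaler_eq0 (negPf l0) => /eqP.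
have surA y : opdom A y -> exists2 x, opdom A x & B (A x) - l *: x = y.
  move=> Ay; have [u [_ ABu] /= uE] := surAB (A y).
  have AxE : A (l^-1 *: (B u - y)) = u.
    rewrite oplinearZ ?oplinearB -?uE//; last exact: opdomB.
    by rewrite opprB addrC subrK scalerA mulVf// scale1r.
  exists (l^-1 *: (B u - y)); first by apply: opdomZ => //; exact: opdomB.
  by rewrite AxE scalerA mulfV// scale1r opprB addrC subrK.
(* With y = (BA - m)^-1 z and (BA - l) x = y, the vector (BA - m) x is the
   preimage of z, as BA - l and BA - m commute. *)
move=> z; have [y [Ay _] /= yE] := surBAm z.
have [x Ax xE] := surA y Ay.
have BAxE : B (A x) = y + l *: x by rewrite -xE subrK.
have ABAx : opdom A (B (A x)).
  by rewrite BAxE; apply: opdomD => //; exact: opdomZ.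
exists (B (A x) - m *: x).
  by split=> //=; apply: opdomB => //; exact: opdomZ.
have Alx := opdomZ A_linear l Ax; have Amx := opdomZ A_linear m Ax.
rewrite /= oplinearB// oplinearZ// oplinearB// oplinearZ//.
rewrite -yE -xE oplinearB// oplinearZ// oplinearB// oplinearZ//.
rewrite !scalerBr !scalerA [l * m]mulrC !opprB !addrA.
by rewrite addrAC [RHS]addrAC; congr (_ + _); exact: addrAC.
Qed.

End Product.

(** * Ranges and kernels of adjoints *)

(** A vector x orthogonal to z is at distance at least |z| from z. *)
Lemma dense_orthogonal0 (D : set H) z :
  dense D -> (forall x, D x -> hdot x z = 0) -> z = 0.
Proof.
move=> Dd Dz; apply/eqP; apply/negPn/negP => z0.
have [||x [zx Dx]] := Dd (ball z `|z|).
- by exists z; apply: ballxx; rewrite normr_gt0.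
- by apply: ball_open; rewrite normr_gt0.
have zx0 : hdot z x = 0 by rewrite hermC/= Dz// conjC0 mulr0.
move: zx; rewrite -ball_normE /= => /lt_geF/negP; apply.
rewrite -(@ler_pXn2r _ 2)// ?nnegrE//= !sqr_norm_hdot.
by rewrite hnormBd// lerDl dnorm_ge0.
Qed.

(** Density of the domain is what forces T* y = 0 in the converse direction: it
   makes 0 the only vector that can serve as T* y. *)
Lemma opker_adjointP T y : densely_defined T ->
  opker (adjoint T) y <-> forall x, opdom T x -> hdot (T x) y = 0.
Proof.
move=> dT; split=> [[[z zP] /= yz0] x Tx|yT].
  have /(_ x Tx) := @xgetI _ 0
    [set z | forall x, opdom T x -> hdot (T x) y = hdot x z] z zP.
  by rewrite yz0 linear0r.
have y0 : forall x, opdom T x -> hdot (T x) y = hdot x 0.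
  by move=> x Tx; rewrite yT// linear0r.
split; first by exists 0.
apply: xget_unique => // z zP; apply: (dense_orthogonal0 dT) => x Tx.
by rewrite -zP// yT.
Qed.

Lemma opker_adjoint_surjective T : densely_defined T ->
  (forall y, exists2 x, opdom T x & T x = y) -> opker (adjoint T) = [set 0].
Proof.
move=> dT surT; apply/seteqP; split=> y.
  move=> /(opker_adjointP _ dT) yT; have [x Tx xE] := surT y.
  by have /eqP := yT x Tx; rewrite xE dnorm_eq0 => /eqP.
by move=> ->; apply/(opker_adjointP _ dT) => x _; rewrite linear0r.
Qed.

Lemma setT_dense : dense (@setT H).
Proof. by move=> U [x Ux] _; exists x. Qed.

(** A range that is the fixed point set of a continuous map is closed, and a
   closed subspace with trivial orthogonal is everything. *)
Lemma range_fixpoints_full T (P : H -> H) :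
  linear_operator T -> continuous P ->
  (forall y, (exists2 x, opdom T x & T x = y) <-> P y = y) ->
  (forall y, (forall x, opdom T x -> hdot (T x) y = 0) -> y = 0) ->
  forall y, exists2 x, opdom T x & T x = y.
Proof.
move=> lT cP TP T0 y.
suff rT : [set y | exists2 x, opdom T x & T x = y] = setT.
  by have : (@setT H) y by []; rewrite -rT.
apply: projection_theorem.
- have -> : [set y | exists2 x, opdom T x & T x = y] = [set y | P y = y].
    by apply/seteqP; split=> z /TP.
  by apply: closed_eq_continuous => // z; exact: cvg_id.
- by exists 0; [exact: opdom0|exact: oplinear0].
- move=> a _ _ [u Tu <-] [v Tv <-]; exists (a *: u + v); first exact: opdomP.
  exact: oplinearP.
- by move=> z zP; apply: T0 => x Tx; apply: zP; exists x.
Qed.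

Lemma injective_opker T : linear_operator T ->
  injective_operator T <-> opker T = [set 0].
Proof.
move=> lT; rewrite injective_operatorP//; split=> [kT|kT x Tx Tx0].
  apply/seteqP; split=> [x [Tx]|_ ->]; first exact: kT.
  by split; [exact: opdom0|exact: oplinear0].
by have : opker T x by []; rewrite kT.
Qed.

(** * The point zero *)

Section ZeroPoint.
Variables A B : operator H.
Hypotheses (A_linear : linear_operator A) (A_closed : closed_operator A).
Hypotheses (A_dense : densely_defined A) (B_bounded : bounded_operator B).
Hypothesis ker_eq : opker (adjoint A) = opker A \/ opker B = opker (adjoint B).

Let domB : opdom B = setT. Proof. by case: B_bounded. Qed.
Let Bdom x : opdom B x. Proof. by rewrite domB. Qed.
Let B_linear : linear_operator B. Proof. by case: B_bounded. Qed.
Let B_dense : densely_defined B.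
Proof. by rewrite /densely_defined domB; exact: setT_dense. Qed.

(** With C = A (BA)^-1, one has B C = 1, so that the range of A, which is that of
   C, is the set of the y with C B y = y. It is therefore closed, which serves
   in the case ker A* = ker A. *)
Lemma bijective_opcomp_BA_AB : closed_operator (opcomp B A) ->
  bijective_operator (opcomp B A) -> bijective_operator (opcomp A B).
Proof.
move=> cBA bBA; have [injBA surBA] := bBA.
have injA : injective_operator A.
  by move=> x y Ax Ay Axy; apply: injBA => //=; rewrite Axy.
have KP y : opdom A (opinv (opcomp B A) y) /\ B (A (opinv (opcomp B A) y)) = y.
  by have [[]] := opinvP (surBA y).
have surB y : exists2 x, opdom B x & B x = y.
  by have [x _ <-] := surBA y; exists (A x).
suff [injB surA] :
    injective_operator B /\ forall y, exists2 x, opdom A x & A x = y.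
  split=> [x y [_ ABx] [_ ABy] /injA/= Bxy|y].
    by apply: injB => //; exact: Bxy.
  have [x Ax <-] := surA y; have [z _ zE] := surB x.
  by exists z; rewrite /= zE.
case: ker_eq => kE.
  have lBA := opcomp_boundedl_linear A_linear B_bounded.
  have cK := bounded_operator_continuous (opinv_bounded lBA cBA bBA).
  have cC : continuous (fun y => A (opinv (opcomp B A) y)).
    apply: closed_graph_continuous.
      by move=> a x y; rewrite opinv_linear// oplinearP//; exact: (KP _).1.
    rewrite (_ : [set p | _] =
        (fun p : H * H => (opinv (opcomp B A) p.1, p.2)) @^-1` opgraph A).
      apply: preimage_closed => // p _; apply: cvg_pair; last exact: cvg_snd.
      by apply: (@continuous_comp _ _ _ fst); [exact: cvg_fst | exact: cK].
    apply/seteqP; split=> -[y z].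
      by move=> /esym zE; apply/opgraphE; split=> //; exact: (KP y).1.
    by move=> /opgraphE[_ /esym].
  have surA : forall y, exists2 x, opdom A x & A x = y.
    apply: (@range_fixpoints_full A
      (fun y => A (opinv (opcomp B A) (B y)))) => //.
    - move=> y.
      apply: (@continuous_comp _ _ _ B (fun y => A (opinv (opcomp B A) y))).
        exact: bounded_operator_continuous.
      exact: cC.
    - move=> y; split=> [[x Ax <-]|yE].
        by congr (A _); exact: (opinvE injBA (conj Ax (Bdom _))).
      by exists (opinv (opcomp B A) (B y)) => //; exact: (KP _).1.
    - move=> y yA; have : opker (adjoint A) y by apply/opker_adjointP.
      by rewrite kE (injective_opker A_linear).1.
  split=> // y1 y2 _ _.
  have [x1 Ax1 <-] := surA y1; have [x2 Ax2 <-] := surA y2.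
  by move=> /injBA ->.
have injB : injective_operator B.
  by apply/injective_opker => //; rewrite kE opker_adjoint_surjective.
split=> // y; have [Ax AxE] := KP (B y).
exists (opinv (opcomp B A) (B y)) => //.
exact: injB.
Qed.

(** The space is the direct sum of ker A and ran B. The sum contains the domain
   of A, because AB is surjective; it is everything, because applying BA - m to
   an element of the sum in the domain of A gives an element of the sum, and
   BA - m is surjective. If B Q x is the component of x in ran B, then Q has the
   closed graph {(x, z) | A (x - B z) = 0}, so that it is continuous and ran B,
   the fixed point set of BQ, is closed. *)
Lemma bijective_opcomp_AB_BA m :
  bijective_operator (opshift (opcomp B A) m) ->
  bijective_operator (opcomp A B) -> bijective_operator (opcomp B A).
Proof.
move=> [_ surBAm] [injAB surAB].
have surA y : exists2 x, opdom A x & A x = y.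
  by have [z [_ ABz] zE] := surAB y; exists (B z).
have B_eq0 z : opker A (B z) -> z = 0.
  move=> [ABz ABz0]; apply: injAB => //=.
    by rewrite oplinear0//; split=> //; exact: opdom0.
  by rewrite ABz0 !oplinear0.
have injB : injective_operator B.
  apply/injective_operatorP => // x _ Bx0; apply: B_eq0; rewrite Bx0.
  by split; [exact: opdom0|exact: oplinear0].
suff [injA surB] :
    injective_operator A /\ forall y, exists2 x, opdom B x & B x = y.
  split=> [x y [Ax _] [Ay _] /= BAxy|y].
    by apply: injA => //; apply: injB BAxy.
  have [z _ <-] := surB y; have [x Ax <-] := surA z.
  by exists x.
have kerP (a : R[i]) x y : opker A x -> opker A y -> opker A (a *: x + y).
  move=> [Ax Ax0] [Ay Ay0]; split; first exact: opdomP.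
  by rewrite oplinearP// Ax0 Ay0 scaler0 addr0.
(* Q x is the B-preimage of the component of x in ran B. *)
have /choice[Q QP] x : exists z, opker A (x - B z).
  have dec u : opdom A u -> exists z, opdom A (B z) /\ opker A (u - B z).
    move=> Au; have [z [_ ABz] /= zE] := surAB (A u); exists z; split=> //.
    by split; [exact: opdomB | rewrite oplinearB// zE subrr].
  have [u [Au _] /= <-] := surBAm x; have [z [ABz kz]] := dec u Au.
  exists (A u - m *: z); rewrite oplinearB// oplinearZ//.
  have -> : B (A u) - m *: u - (B (A u) - m *: B z) = - m *: (u - B z) + 0.
    by rewrite addr0 scaleNr scalerBr !opprB addrC addrA subrK.
  by apply: kerP => //; split; [exact: opdom0|exact: oplinear0].
have B_perp y : opker B = opker (adjoint B) ->
    (forall x, opdom B x -> hdot (B x) y = 0) -> y = 0.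
  move=> kE yB; have : opker (adjoint B) y by apply/opker_adjointP.
  by rewrite -kE (injective_opker B_linear).1.
have Q_uniq x z : opker A (x - B z) -> z = Q x.
  move=> kz; apply: subr0_eq; apply: B_eq0; rewrite oplinearB//.
  have := kerP (-1) _ _ kz (QP x); rewrite scaleN1r opprB addrA.
  by rewrite subrK.
case: ker_eq => kE.
  have injA : injective_operator A.
    by apply/injective_opker => //; rewrite -kE opker_adjoint_surjective.
  split=> // x; exists (Q x) => //; have := QP x.
  by rewrite (injective_opker A_linear).1// => /subr0_eq.
have cQ : continuous Q.
  apply: closed_graph_continuous.
    move=> a x y; apply/esym/Q_uniq; rewrite oplinearP//.
    have := kerP a _ _ (QP x) (QP y).
    by rewrite scalerBr opprD addrACA.
  rewrite (_ : [set p | _] =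
      (fun p : H * H => (p.1 - B p.2, 0)) @^-1` opgraph A).
    apply: preimage_closed => // p _; apply: cvg_pair; last exact: cvg_cst.
    apply: cvgB; first exact: cvg_fst.
    apply: (@continuous_comp _ _ _ snd); first exact: cvg_snd.
    exact: bounded_operator_continuous.
  apply/seteqP; split=> -[x z] /=.
    by move=> ->; apply/opgraphE; exact: QP.
  by move=> /opgraphE; exact: Q_uniq.
have surB : forall y, exists2 x, opdom B x & B x = y.
  apply: (@range_fixpoints_full B (fun y => B (Q y))) => //.
  - move=> y; apply: (@continuous_comp _ _ _ Q B); first exact: cQ.
    exact: bounded_operator_continuous.
  - move=> y; split=> [[x _ <-]|yE]; last by exists (Q y).
    congr (B _); apply/esym/Q_uniq; rewrite subrr.
    by split; [exact: opdom0|exact: oplinear0].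
  - by move=> y; exact: B_perp.
split=> //; apply/injective_operatorP => // x Ax Ax0.
have [z _ zE] := surB x.
by rewrite -zE (B_eq0 z) ?oplinear0// zE.
Qed.

End ZeroPoint.

End Operators.

(** * Equality of the spectra *)

Theorem corollary3p4 (R : realType) (H : hilbertType R)
    (Hsep : separable H) (A B : operator H)
    (A_linear : linear_operator A) (A_closed : closed_operator A)
    (A_dense : densely_defined A) (B_bounded : bounded_operator B)
    (BsAs_spectrum : spectrum (opcomp (adjoint B) (adjoint A)) <> setT)
    (BA_spectrum : spectrum (opcomp B A) <> setT)
    (ker_eq : opker (adjoint A) = opker A \/ opker B = opker (adjoint B)) :
  spectrum (opcomp B A) = spectrum (opcomp A B).
Proof.
have [m rm] : exists m, ~ spectrum (opcomp B A) m.
  apply: contrapT => no; apply: BA_spectrum; apply/seteqP; split=> // l _.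
  by apply: contrapT => rl; apply: no; exists l.
have bm := bijective_of_resolvent rm.
have cBA := closed_of_resolvent rm.
have cAB := opcomp_boundedr_closed B_bounded A_closed.
have lBA := opcomp_boundedl_linear A_linear B_bounded.
have lAB := opcomp_boundedr_linear A_linear B_bounded.
suff bij l : bijective_operator (opshift (opcomp B A) l) <->
    bijective_operator (opshift (opcomp A B) l).
  apply/seteqP; split=> l; apply: contraPP => /bijective_of_resolvent/bij.
    by move/(resolventP _ lBA cBA).
  by move/(resolventP _ lAB cAB).
have [->|l0] := eqVneq l 0.
  rewrite !opshift0; split; first exact: bijective_opcomp_BA_AB.
  exact: (bijective_opcomp_AB_BA A_linear A_closed A_dense B_bounded ker_eq bm).
split; first exact: bijective_shift_swap.
exact: (bijective_shift_swapV A_linear B_bounded l0 bm).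
Qed.
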